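(* Let $q\in\mathbb F$ with $q\neq0,\pm1$, and let $A$ be a vector space with a bilinear operation $\ast$. Let $(A,\circ)$ be the $(-q)$-algebra of $(A,\ast)$, i.e. $x\circ y=x\ast y-q\,y\ast x$ for all $x,y\in A$. Write $[x,y]=x\ast y-y\ast x$ and $[x,y]_\circ=x\circ y-y\circ x$. Then the following are equivalent. (i) $(A,\ast)$ is a pre-Lie algebra satisfying, for all $x,y,z\in A$, $$(2+q)[x,y]\ast z+(-q^2-2q)\,z\ast[x,y]+(q^2-q)\big((z\ast y)\ast x-(z\ast x)\ast y\big)=0.$$ (ii) $(A,\circ)$ is an anti-pre-Lie algebra satisfying, for all $x,y,z\in A$, $$(2+q)[x,y]_\circ\circ z-q^2\,z\circ[x,y]_\circ+(q^2+q)\big((z\circ x)\circ y-(z\circ y)\circ x\big)=0.$$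
   Context: All vector spaces are finite-dimensional over a field $\mathbb F$ of characteristic $0$. Pre-Lie algebra: a vector space $A$ with a bilinear operation $\ast$ such that $(x\ast y)\ast z-x\ast(y\ast z)=(y\ast x)\ast z-y\ast(x\ast z)$ for all $x,y,z\in A$. Anti-pre-Lie algebra: a vector space $A$ with a bilinear operation $\circ$ such that, with $[x,y]_\circ=x\circ y-y\circ x$, for all $x,y,z\in A$, $$x\circ(y\circ z)-y\circ(x\circ z)=[y,x]_\circ\circ z,\qquad [x,y]_\circ\circ z+[y,z]_\circ\circ x+[z,x]_\circ\circ y=0.$$ *)

(* Defs.v *)
From HB Require Import structures.
From mathcomp Require Import all_boot all_order all_algebra.

Set Implicit Arguments.
Unset Strict Implicit.
Unset Printing Implicit Defensive.

Import GRing.Theory.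
Local Open Scope ring_scope.

Section Algebras.
Variables (F : fieldType) (A : vectType F).

Definition comm_op (op : A -> A -> A) (x y : A) : A := op x y - op y x.

Definition is_pre_lie (op : {bilinear A -> A -> A}) : Prop :=
  forall x y z : A,
    op (op x y) z - op x (op y z) = op (op y x) z - op y (op x z).

Definition is_anti_pre_lie (op : {bilinear A -> A -> A}) : Prop :=
  (forall x y z : A,
     op x (op y z) - op y (op x z) = op (comm_op op y x) z) /\
  (forall x y z : A,
     op (comm_op op x y) z + op (comm_op op y z) x
       + op (comm_op op z x) y = 0).

(* The product of the p-algebra of (A, op).  The algebra whose product is
   op x y - q *: op y x is the (- q)-algebra, i.e. [q_op (- q) op].           *)
Definition q_op (p : F) (op : A -> A -> A) (x y : A) : A :=
  op x y + p *: op y x.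

Section QOpBilinear.
Variables (p : F) (op : {bilinear A -> A -> A}).

Lemma q_op_is_bilinear :
  bilinear_for
    (GRing.Scale.Law.clone _ _ *:%R _) (GRing.Scale.Law.clone _ _ *:%R _)
    (q_op p op).
Proof.
split=> [x|x] a y z /=; rewrite /q_op /= !linearPl !linearPr /=.
  by rewrite !scalerDr !scalerA (mulrC p a) addrACA.
by rewrite !scalerDr !scalerA (mulrC p a) addrACA.
Qed.

HB.instance Definition _ :=
  bilinear_isBilinear.Build F A A A _ _ (q_op p op) q_op_is_bilinear.

End QOpBilinear.

End Algebras.

(* Main.v *)
Require Import Defs.
From mathcomp Require Import all_boot all_order all_algebra.
From mathcomp Require Import ring.
Import GRing.Theory VectorInternalTheory.
Local Open Scope ring_scope.

(** Both (i) and (ii) are linear conditions on the twelve monomials of degree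
    three in [x], [y], [z].  Permuting the variables acts on these conditions,
    and each splits into an alternating part and a remainder.

    Write J and K for the cyclic sums of [[x,y] * z] and [z * [x,y]], D for the
    defect [x*(y*z) - y*(x*z) - [x,y]*z] of the pre-Lie identity, and S for
    the left-hand side of the second identity of (i); primes denote the same
    expressions for the product [circ].  Thus (i) says D = S = 0.

    The alternating part consists of J and K, and both conditions force
    J = K = 0.  Under (i), the cyclic sums of D and S give K = J and
    2 (1 - q^2) J = 0.  Under (ii), J' = 0 by definition, and the cyclic sum of
    the first anti-pre-Lie identity gives K' = - J' = 0; since
    J' = (1 + q) (J - q K) and K' = (1 + q) (K - q J), J and K vanish
    (lemmas [pre_lie_alternating] and [anti_pre_lie_alternating]).

    Modulo J and K, expanding [circ] shows that the defect of the first
    anti-pre-Lie identity is S + (1 - q) D, and that the left-hand side of the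
    second identity of (ii) is (1 + q) (S + q^2 (1 - q) D)
    (lemmas [anti_pre_lie_defect_q_op] and [q_residue_q_op]).  These are two
    combinations of S and D whose determinant is, up to sign,
    (1 + q) (1 - q) (1 - q^2).  It is invertible, so they vanish together
    exactly when S and D do. *)

Section DegreeThree.
Context {F : fieldType} {A : vectType F}.

(** * Identities between vectors *)

Lemma v2r_addE (u v : A) i : v2r (u + v) 0 i = v2r u 0 i + v2r v 0 i.
Proof. by rewrite linearD mxE. Qed.

Lemma v2r_oppE (u : A) i : v2r (- u) 0 i = - v2r u 0 i.
Proof. by rewrite linearN mxE. Qed.

Lemma v2r_scaleE k (u : A) i : v2r (k *: u) 0 i = k * v2r u 0 i.
Proof. by rewrite linearZ mxE. Qed.

(** An identity between linear combinations of vectors holds as soon as it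
    does in coordinates, where it is a polynomial identity in the field. *)
Ltac module_ring :=
  apply: v2r_inj; apply/rowP => ?;
  rewrite ?(v2r_addE, v2r_oppE, v2r_scaleE); ring.

(** * Expressions of degree three *)

Section Expressions.
Variable op : A -> A -> A.

Definition jacobi_left (x y z : A) : A :=
  op (comm_op op x y) z + op (comm_op op y z) x + op (comm_op op z x) y.

Definition jacobi_right (x y z : A) : A :=
  op z (comm_op op x y) + op x (comm_op op y z) + op y (comm_op op z x).

Definition pre_lie_defect (x y z : A) : A :=
  op x (op y z) - op y (op x z) - op (comm_op op x y) z.

Definition anti_pre_lie_defect (x y z : A) : A :=
  op x (op y z) - op y (op x z) + op (comm_op op x y) z.

(** The two additional identities have this shape: the one for [star] at
    [(2 + q, - q^2 - 2 q, q - q^2)], the one for [circ] at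
    [(2 + q, - q^2, q^2 + q)]. *)
Definition comm_residue (a b c : F) (x y z : A) : A :=
  a *: op (comm_op op x y) z + b *: op z (comm_op op x y)
  + c *: (op (op z x) y - op (op z y) x).

End Expressions.

(** * Cyclic sums and the change of product *)

Variable op : {bilinear A -> A -> A}.

Let opDl u v w : op (u + v) w = op u w + op v w.
Proof. exact: linearDl. Qed.
Let opNl u w : op (- u) w = - op u w.
Proof. exact: linearNl. Qed.
Let opZl k u w : op (k *: u) w = k *: op u w.
Proof. exact: linearZl_LR. Qed.
Let opDr u v w : op w (u + v) = op w u + op w v.
Proof. exact: linearDr. Qed.
Let opNr u w : op w (- u) = - op w u.
Proof. exact: linearNr. Qed.
Let opZr k u w : op w (k *: u) = k *: op w u.
Proof. exact: linearZr_LR. Qed.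

(** Bilinearity leaves a linear combination of the twelve monomials of degree
    three; generalizing them forgets the product before coordinates are
    taken, so that only linear algebra remains. *)
Ltac expand_products :=
  rewrite /jacobi_left /jacobi_right /pre_lie_defect /anti_pre_lie_defect
    /comm_residue /comm_op /q_op;
  rewrite !(opDl, opNl, opZl, opDr, opNr, opZr);
  repeat (move: (op _ (op _ _)) => ?);
  repeat (move: (op (op _ _) _) => ?);
  module_ring.

Lemma anti_pre_lie_defectE x y z :
  anti_pre_lie_defect op x y z =
  op x (op y z) - op y (op x z) - op (comm_op op y x) z.
Proof. by expand_products. Qed.

Lemma cyclic_pre_lie_defect x y z :
  pre_lie_defect op x y z + pre_lie_defect op y z x + pre_lie_defect op z x y
  = jacobi_right op x y z - jacobi_left op x y z.
Proof. by expand_products. Qed.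

Lemma cyclic_anti_pre_lie_defect x y z :
  anti_pre_lie_defect op x y z + anti_pre_lie_defect op y z x
    + anti_pre_lie_defect op z x y
  = jacobi_right op x y z + jacobi_left op x y z.
Proof. by expand_products. Qed.

(** The terms with coefficient [c] regroup into commutators, so they also
    contribute to the left Jacobi sum. *)
Lemma cyclic_comm_residue a b c x y z :
  comm_residue op a b c x y z + comm_residue op a b c y z x
    + comm_residue op a b c z x y
  = (a + c) *: jacobi_left op x y z + b *: jacobi_right op x y z.
Proof. by expand_products. Qed.

Lemma jacobi_left_q_op q x y z :
  jacobi_left (q_op (- q) op) x y z =
  (1 + q) *: (jacobi_left op x y z - q *: jacobi_right op x y z).
Proof. by expand_products. Qed.

Lemma jacobi_right_q_op q x y z :
  jacobi_right (q_op (- q) op) x y z =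
  (1 + q) *: (jacobi_right op x y z - q *: jacobi_left op x y z).
Proof. by expand_products. Qed.

(** This and the next identity are the heart of the proof: up to Jacobi sums,
    both identities required of [circ] are combinations of the two required of
    [star]. *)
Lemma anti_pre_lie_defect_q_op q x y z :
  anti_pre_lie_defect (q_op (- q) op) x y z =
  comm_residue op (2 + q) (- q ^+ 2 - 2 * q) (q - q ^+ 2) x y z
  + (1 - q) *: pre_lie_defect op x y z
  + q *: (jacobi_right op x y z - jacobi_left op x y z).
Proof. by expand_products. Qed.

Lemma q_residue_q_op q x y z :
  comm_residue (q_op (- q) op) (2 + q) (- q ^+ 2) (q ^+ 2 + q) x y z =
  (1 + q) *:
    (comm_residue op (2 + q) (- q ^+ 2 - 2 * q) (q - q ^+ 2) x y z
     + (q ^+ 2 * (1 - q)) *: pre_lie_defect op x y z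
     + q ^+ 2 *: (jacobi_left op x y z - jacobi_right op x y z)).
Proof. by expand_products. Qed.

Lemma is_pre_lieP :
  is_pre_lie op <-> forall x y z, pre_lie_defect op x y z = 0.
Proof.
have opp_defect x y z : op (op x y) z - op x (op y z)
    - (op (op y x) z - op y (op x z)) = - pre_lie_defect op x y z.
  by expand_products.
split=> H x y z; apply/eqP.
  by rewrite -oppr_eq0 -opp_defect subr_eq0 H.
by rewrite -subr_eq0 opp_defect H oppr0.
Qed.

Lemma is_anti_pre_lieP :
  is_anti_pre_lie op <->
  (forall x y z, anti_pre_lie_defect op x y z = 0) /\
  (forall x y z, jacobi_left op x y z = 0).
Proof.
split=> -[H J]; split=> // x y z.
  by rewrite anti_pre_lie_defectE H subrr.
by apply/eqP; rewrite -subr_eq0 -anti_pre_lie_defectE H.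
Qed.

(** * Vanishing of the Jacobi sums *)

Lemma pre_lie_alternating q :
  (2 : F) != 0 -> 1 - q ^+ 2 != 0 ->
  (forall x y z, pre_lie_defect op x y z = 0) ->
  (forall x y z,
    comm_residue op (2 + q) (- q ^+ 2 - 2 * q) (q - q ^+ 2) x y z = 0) ->
  forall x y z, jacobi_left op x y z = 0 /\ jacobi_right op x y z = 0.
Proof.
move=> two_neq0 q2_neq1 D0 S0 x y z.
have := cyclic_pre_lie_defect x y z; rewrite !D0 !addr0 => /esym/eqP.
rewrite subr_eq0 => /eqP KJ; rewrite KJ.
have /esym := cyclic_comm_residue (2 + q) (- q ^+ 2 - 2 * q) (q - q ^+ 2) x y z.
rewrite !S0 !addr0 KJ -scalerDl.
have -> : 2 + q + (q - q ^+ 2) + (- q ^+ 2 - 2 * q) = 2 * (1 - q ^+ 2).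
  by ring.
move/eqP; rewrite scaler_eq0 mulf_eq0 (negPf two_neq0) (negPf q2_neq1) /=.
by move/eqP.
Qed.

Lemma anti_pre_lie_alternating q :
  1 + q != 0 -> 1 - q ^+ 2 != 0 ->
  (forall x y z, jacobi_left (q_op (- q) op) x y z = 0) ->
  (forall x y z, jacobi_right (q_op (- q) op) x y z = 0) ->
  forall x y z, jacobi_left op x y z = 0 /\ jacobi_right op x y z = 0.
Proof.
move=> q1_neq0 q2_neq1 J0 K0 x y z.
have /eqP := J0 x y z; rewrite jacobi_left_q_op scaler_eq0 (negPf q1_neq0) /=.
rewrite subr_eq0 => /eqP JK.
have /eqP := K0 x y z; rewrite jacobi_right_q_op scaler_eq0 (negPf q1_neq0) /=.
rewrite JK scalerA -[X in X - _]scale1r -scalerBl -expr2.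
rewrite scaler_eq0 (negPf q2_neq1) /= => /eqP ->.
by rewrite scaler0.
Qed.

End DegreeThree.

(** * The equivalence *)

Theorem theorem3p19 (F : fieldType) (charF0 : [pchar F] =i pred0)
    (A : vectType F) (q : F) (q_neq0 : q != 0) (q_neq1 : q != 1)
    (q_neqN1 : q != -1) (star : {bilinear A -> A -> A}) :
  let circ : {bilinear A -> A -> A} := q_op (- q) star in
  (is_pre_lie star /\
   forall x y z : A,
     (2 + q) *: star (comm_op star x y) z
     + (- q ^+ 2 - 2 * q) *: star z (comm_op star x y)
     + (q ^+ 2 - q) *: (star (star z y) x - star (star z x) y) = 0)
  <->
  (is_anti_pre_lie circ /\
   forall x y z : A,
     (2 + q) *: circ (comm_op circ x y) z
     - q ^+ 2 *: circ z (comm_op circ x y)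
     + (q ^+ 2 + q) *: (circ (circ z x) y - circ (circ z y) x) = 0).
Proof.
move=> circ.
have two_neq0 : (2 : F) != 0 by rewrite ((pcharf0P F).1 charF0 2).
have q1_neq0 : 1 + q != 0 by rewrite addrC -[1]opprK subr_eq0.
have q1N_neq0 : 1 - q != 0 by rewrite subr_eq0 eq_sym.
have q2E : 1 - q ^+ 2 = (1 - q) * (1 + q) by ring.
have q2_neq1 : 1 - q ^+ 2 != 0 by rewrite q2E mulf_neq0.
have starE x y z :
    (2 + q) *: star (comm_op star x y) z
    + (- q ^+ 2 - 2 * q) *: star z (comm_op star x y)
    + (q ^+ 2 - q) *: (star (star z y) x - star (star z x) y)
    = comm_residue star (2 + q) (- q ^+ 2 - 2 * q) (q - q ^+ 2) x y z.
  by rewrite /comm_residue -[q ^+ 2 - q]opprB scaleNr -scalerN opprB.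
have circE x y z :
    (2 + q) *: circ (comm_op circ x y) z
    - q ^+ 2 *: circ z (comm_op circ x y)
    + (q ^+ 2 + q) *: (circ (circ z x) y - circ (circ z y) x)
    = comm_residue circ (2 + q) (- q ^+ 2) (q ^+ 2 + q) x y z.
  by rewrite /comm_residue scaleNr.
split.
  case=> /is_pre_lieP D0 S0'.
  have S0 x y z := etrans (esym (starE x y z)) (S0' x y z).
  have JK0 := pre_lie_alternating _ _ two_neq0 q2_neq1 D0 S0.
  split; last first.
    move=> x y z; have [J0 K0] := JK0 x y z.
    by rewrite circE q_residue_q_op S0 D0 J0 K0 subrr !scaler0 !addr0 scaler0.
  apply/is_anti_pre_lieP; split=> x y z; have [J0 K0] := JK0 x y z.
    by rewrite anti_pre_lie_defect_q_op S0 D0 J0 K0 subrr !scaler0 !addr0.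
  by rewrite jacobi_left_q_op J0 K0 scaler0 subrr scaler0.
case=> /is_anti_pre_lieP [D0' J0'] E0'.
have K0' x y z : jacobi_right circ x y z = 0.
  have := cyclic_anti_pre_lie_defect circ x y z.
  by rewrite !D0' !addr0 J0' addr0 => <-.
have JK0 := anti_pre_lie_alternating _ _ q1_neq0 q2_neq1 J0' K0'.
(* The first anti-pre-Lie identity gives S in terms of D; substituting into the
   additional identity for [circ] leaves D times the determinant of the
   system. *)
have SD1 x y z : comm_residue star (2 + q) (- q ^+ 2 - 2 * q) (q - q ^+ 2) x y z
    = - ((1 - q) *: pre_lie_defect star x y z).
  have [J0 K0] := JK0 x y z; apply/eqP; rewrite -addr_eq0.
  have := D0' x y z; rewrite anti_pre_lie_defect_q_op J0 K0 subrr scaler0 addr0.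
  by move=> ->.
have D0 x y z : pre_lie_defect star x y z = 0.
  have [J0 K0] := JK0 x y z; have /eqP := E0' x y z.
  rewrite circE q_residue_q_op J0 K0 subrr scaler0 addr0 SD1.
  rewrite -scaleNr -scalerDl scalerA.
  have -> : (1 + q) * (- (1 - q) + q ^+ 2 * (1 - q))
      = - ((1 + q) * (1 - q) * (1 - q ^+ 2)) by ring.
  rewrite scaler_eq0 oppr_eq0 !mulf_eq0 (negPf q1_neq0) (negPf q1N_neq0).
  by rewrite (negPf q2_neq1) => /eqP.
split; first exact/is_pre_lieP.
by move=> x y z; rewrite starE SD1 D0 scaler0 oppr0.
Qed.
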